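(* Let $(c^{n},\bar\mu_c^{n},\bar p^{n},\boldsymbol{u}^{n})_{n\ge 0}$, $\boldsymbol{u}^n=(u^n,v^n)$, be grid functions such that, for every $n\ge 0$, the data at levels $n$ and $n+1$ satisfy the fully discrete primitive scheme (equations (P1)--(P5) of the context), and such that the discrete boundary conditions of the context hold at every level. Write $\rho^n=\rho(c^n)$. Then the total mass of the binary fluid is conserved: $$(\rho^{n+1},1)_2=(\rho^{n},1)_2\qquad\text{for all } n\ge 0 .$$
   Context: **Parameters and material functions.** $M,Re,We,Fr,Pe,\eta,\epsilon,\rho_1,\rho_2,\mu_1,\mu_2,\delta t>0$ are constants; $\alpha=(\rho_2-\rho_1)/(\rho_1\rho_2)$; $\rho(c)=\rho_1\rho_2/((\rho_2-\rho_1)c+\rho_1)$; $\mu(c)=\mu_1\mu_2/((\mu_2-\mu_1)c+\mu_1)$ (viscosity); $m(c)=\sqrt{c^2(1-c)^2+\epsilon}$; $F(c)=c^2(c-1)^2/4$; $g(a,b)=\frac14\big(a(a-1)+b(b-1)\big)(a+b-1)$; $r(a,b)=-\alpha\rho(a)\rho(b)$. All values of $c^n$ are such that $(\rho_2-\rho_1)c+\rho_1>0$ and $(\mu_2-\mu_1)c+\mu_1>0$. Superscript $n$ denotes time level $n\delta t$; $\rho^n=\rho(c^n)$, $\rho^{n+\frac12}=\frac12(\rho^{n+1}+\rho^n)$, $c^{n+\frac12}=\frac12(c^{n+1}+c^n)$, $F^{n+\frac12}=\frac12(F(c^{n+1})+F(c^n))$. **Grid.** $\Omega=(0,L_x)\times(0,L_y)$,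 $L_x=m_1h$, $L_y=m_2h$, $h>0$, $m_1,m_2$ positive integers, $L_x=L_y$. Points: $x_i=(i-\frac12)h$, $x_{i+\frac12}=ih$, $y_j=(j-\frac12)h$, $y_{j+\frac12}=jh$. Cell-centered functions $\phi_{i,j}$ ($c,\bar\mu_c,\mu_c,\bar p$) are indexed by $0\le i\le m_1+1$, $0\le j\le m_2+1$ (indices $0$, $m_1+1$, $m_2+1$ are ghost points). East-west edge-centered functions $u_{i+\frac12,j}$ live at $(x_{i+\frac12},y_j)$, $0\le i\le m_1$, $0\le j\le m_2+1$; north-south edge-centered functions $v_{i,j+\frac12}$ at $(x_i,y_{j+\frac12})$, $0\le i\le m_1+1$, $0\le j\le m_2$; vertex-centered functions $f_{i+\frac12,j+\frac12}$, $0\le i\le m_1$, $0\le j\le m_2$. Products of grid functions at the same type of points are pointwise. $(\phi,\psi)_2=\sum_{i=1}^{m_1}\sum_{j=1}^{m_2}\phi_{i,j}\psi_{i,j}$. **Operators.** - Edge to center: $a_xu_{i,j}=\frac12(u_{i+\frac12,j}+u_{i-\frac12,j})$, $d_xu_{i,j}=\frac1h(u_{i+\frac12,j}-u_{i-\frac12,j})$, $a_yv_{i,j}=\frac12(v_{i,j+\frac12}+v_{i,j-\frac12})$, $d_yv_{i,j}=\frac1h(v_{i,j+\frac12}-v_{i,j-\frac12})$. - Center to edge: $A_x\phi_{i+\frac12,j}=\frac12(\phi_{i+1,j}+\phi_{i,j})$, $D_x\phi_{i+\frac12,j}=\frac1h(\phi_{i+1,j}-\phi_{i,j})$, $A_y\phi_{i,j+\frac12}=\frac12(\phi_{i,j+1}+\phi_{i,j})$,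 $D_y\phi_{i,j+\frac12}=\frac1h(\phi_{i,j+1}-\phi_{i,j})$. - Center to vertex: $\mathcal A\phi_{i+\frac12,j+\frac12}=\frac14(\phi_{i+1,j+1}+\phi_{i,j+1}+\phi_{i+1,j}+\phi_{i,j})$. - Edge to vertex: $\mathcal A_xv_{i+\frac12,j+\frac12}=\frac12(v_{i+1,j+\frac12}+v_{i,j+\frac12})$, $\mathcal D_xv_{i+\frac12,j+\frac12}=\frac1h(v_{i+1,j+\frac12}-v_{i,j+\frac12})$, $\mathcal A_yu_{i+\frac12,j+\frac12}=\frac12(u_{i+\frac12,j+1}+u_{i+\frac12,j})$, $\mathcal D_yu_{i+\frac12,j+\frac12}=\frac1h(u_{i+\frac12,j+1}-u_{i+\frac12,j})$. - Vertex to edge: $\mathfrak A_xf_{i,j+\frac12}=\frac12(f_{i+\frac12,j+\frac12}+f_{i-\frac12,j+\frac12})$, $\mathfrak D_xf_{i,j+\frac12}=\frac1h(f_{i+\frac12,j+\frac12}-f_{i-\frac12,j+\frac12})$, $\mathfrak A_yf_{i+\frac12,j}=\frac12(f_{i+\frac12,j+\frac12}+f_{i+\frac12,j-\frac12})$, $\mathfrak D_yf_{i+\frac12,j}=\frac1h(f_{i+\frac12,j+\frac12}-f_{i+\frac12,j-\frac12})$. - Special advection terms: $a_x(\rho_{ew}D_xc\,u)_{i,j}=\frac12\big(\rho_{i+1,j}D_xc_{i+\frac12,j}u_{i+\frac12,j}+\rho_{i-1,j}D_xc_{i-\frac12,j}u_{i-\frac12,j}\big)$ and $a_y(\rho_{ns}D_yc\,v)_{i,j}=\frac12\big(\rho_{i,j+1}D_yc_{i,j+\frac12}v_{i,j+\frac12}+\rho_{i,j-1}D_yc_{i,j-\frac12}v_{i,j-\frac12}\big)$.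 - Special surface tension terms: $A_x(\rho_{ew}\bar\mu_c)_{i+\frac12,j}=\frac12(\rho_{i+1,j}\bar\mu_{c\,i,j}+\rho_{i,j}\bar\mu_{c\,i+1,j})$ and $A_y(\rho_{ns}\bar\mu_c)_{i,j+\frac12}=\frac12(\rho_{i,j+1}\bar\mu_{c\,i,j}+\rho_{i,j}\bar\mu_{c\,i,j+1})$. - Cell-centered squared gradient: $|\nabla_Dc|^2=a_x\big((D_xc)^2\big)+a_y\big((D_yc)^2\big)$, and $(|\nabla_Dc|^2)^{n+\frac12}=\frac12\big(|\nabla_Dc^{n+1}|^2+|\nabla_Dc^{n}|^2\big)$. **Primitive scheme.** (P1) holds at interior east-west edges ($1\le i\le m_1-1$, $1\le j\le m_2$), (P2) at interior north-south edges ($1\le i\le m_1$, $1\le j\le m_2-1$), (P3)--(P5) at cells $1\le i\le m_1$, $1\le j\le m_2$. (P1) $A_x\rho^n\frac{u^{n+1}-u^n}{\delta t}+A_x(\rho^na_xu^n\,d_xu^{n+1})+\mathfrak A_y(\mathcal A\rho^n\mathcal A_xv^n\mathcal D_yu^{n+1})+\frac{A_x\rho^{n+1}-A_x\rho^n}{2\delta t}u^{n+1}+\frac12\big(D_x(\rho^na_xu^n)+\mathfrak D_y(\mathcal A\rho^n\mathcal A_xv^n)\big)u^{n+1}=-\frac1MD_x\bar p^{n+1}+\frac1MA_x(\rho^n_{ew}\bar\mu_c^{n+1})D_xc^n+\frac1{Re}\big(D_x(\mu(c^n)d_xu^{n+1})+\mathfrak D_y(\mathcal A\mu(c^n)\mathcal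 D_yu^{n+1})\big)+\frac1{3Re}D_x\big(\mu(c^n)(d_xu^{n+1}+d_yv^{n+1})\big)$ (P2) $A_y\rho^n\frac{v^{n+1}-v^n}{\delta t}+\mathfrak A_x(\mathcal A\rho^n\mathcal A_yu^n\mathcal D_xv^{n+1})+A_y(\rho^na_yv^n\,d_yv^{n+1})+\frac{A_y\rho^{n+1}-A_y\rho^n}{2\delta t}v^{n+1}+\frac12\big(\mathfrak D_x(\mathcal A\rho^n\mathcal A_yu^n)+D_y(\rho^na_yv^n)\big)v^{n+1}=-\frac1MD_y\bar p^{n+1}+\frac1MA_y(\rho^n_{ns}\bar\mu_c^{n+1})D_yc^n+\frac1{Re}\big(\mathfrak D_x(\mathcal A\mu(c^n)\mathcal D_xv^{n+1})+D_y(\mu(c^n)d_yv^{n+1})\big)+\frac1{3Re}D_y\big(\mu(c^n)(d_xu^{n+1}+d_yv^{n+1})\big)-\frac1{Fr}A_y\rho^n$ (P3) $d_xu^{n+1}+d_yv^{n+1}=\alpha\,Q^{n+1}$, where $Q^{n+1}=\frac1{Pe}\big[d_x(A_xm(c^n)D_x\bar\mu_c^{n+1})+d_y(A_ym(c^n)D_y\bar\mu_c^{n+1})\big]+\frac{\alpha}{Pe}\big[d_x(A_xm(c^n)D_x\bar p^{n+1})+d_y(A_ym(c^n)D_y\bar p^{n+1})\big]$ (P4) $\rho^{n+1}\frac{c^{n+1}-c^n}{\delta t}+a_x(\rho^n_{ew}D_xc^n\,u^{n+1})+a_y(\rho^n_{ns}D_yc^n\,v^{n+1})=Q^{n+1}$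 (P5) $\rho^{n+1}\bar\mu_c^{n+1}=\frac{M\eta}{\epsilon We}\rho^{n+\frac12}g(c^{n+1},c^n)+\frac{M\eta}{\epsilon We}F^{n+\frac12}r(c^{n+1},c^n)+\frac{\epsilon\eta M}{2We}(|\nabla_Dc|^2)^{n+\frac12}r(c^{n+1},c^n)-\frac{\epsilon\eta M}{We}\big[d_x(A_x\rho^{n+\frac12}D_xc^{n+\frac12})+d_y(A_y\rho^{n+\frac12}D_yc^{n+\frac12})\big]$ **Boundary conditions (all levels).** With $\mu_c^n:=\bar\mu_c^n+\alpha\bar p^n$, both $\phi=c^n$ and $\phi=\mu_c^n$ satisfy the discrete Neumann conditions $\phi_{0,j}=\phi_{1,j}$, $\phi_{m_1+1,j}=\phi_{m_1,j}$ ($1\le j\le m_2$), $\phi_{i,0}=\phi_{i,1}$, $\phi_{i,m_2+1}=\phi_{i,m_2}$ ($1\le i\le m_1$). The velocity satisfies no-slip: $u_{\frac12,j}=u_{m_1+\frac12,j}=0$ ($1\le j\le m_2$), $\frac12(u_{i+\frac12,0}+u_{i+\frac12,1})=\frac12(u_{i+\frac12,m_2}+u_{i+\frac12,m_2+1})=0$ ($0\le i\le m_1$), $v_{i,\frac12}=v_{i,m_2+\frac12}=0$ ($1\le i\le m_1$), $\frac12(v_{0,j+\frac12}+v_{1,j+\frac12})=\frac12(v_{m_1,j+\frac12}+v_{m_1+1,j+\frac12})=0$ ($0\le j\le m_2$). *)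

(* Defs.v *)
From mathcomp Require Import all_boot all_order all_algebra.
From mathcomp Require Import reals.

Set Implicit Arguments.
Unset Strict Implicit.
Unset Printing Implicit Defensive.

Import Order.TTheory GRing.Theory Num.Theory.
Local Open Scope ring_scope.

Record params (R : realType) := Params {
  pM : R; pRe : R; pWe : R; pFr : R; pPe : R;
  peta : R; peps : R;
  prho1 : R; prho2 : R; pmu1 : R; pmu2 : R;
  pdt : R }.

Record params_pos (R : realType) (p : params R) : Prop := ParamsPos {
  pM_gt0 : 0 < pM p; pRe_gt0 : 0 < pRe p; pWe_gt0 : 0 < pWe p;
  pFr_gt0 : 0 < pFr p; pPe_gt0 : 0 < pPe p;
  peta_gt0 : 0 < peta p; peps_gt0 : 0 < peps p;
  prho1_gt0 : 0 < prho1 p; prho2_gt0 : 0 < prho2 p;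
  pmu1_gt0 : 0 < pmu1 p; pmu2_gt0 : 0 < pmu2 p;
  pdt_gt0 : 0 < pdt p }.

Section Material.
Context {R : realType}.
Implicit Types (p : params R) (a b c : R).

Definition alpha p : R := (prho2 p - prho1 p) / (prho1 p * prho2 p).
Definition rho p c : R :=
  prho1 p * prho2 p / ((prho2 p - prho1 p) * c + prho1 p).
Definition visc p c : R :=
  pmu1 p * pmu2 p / ((pmu2 p - pmu1 p) * c + pmu1 p).
Definition mob p c : R := Num.sqrt (c ^+ 2 * (1 - c) ^+ 2 + peps p).
Definition Fdw c : R := c ^+ 2 * (c - 1) ^+ 2 / 4.
Definition gdw a b : R :=
  4^-1 * (a * (a - 1) + b * (b - 1)) * (a + b - 1).
Definition rfun p a b : R := - alpha p * rho p a * rho p b.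

End Material.

(* Half-integer indices are stored by their floor:
     cellfun  phi i j = phi_(i, j)            0 <= i <= m1+1, 0 <= j <= m2+1
     ewfun    u i j   = u_(i+1/2, j)          0 <= i <= m1,   0 <= j <= m2+1
     nsfun    v i j   = v_(i, j+1/2)          0 <= i <= m1+1, 0 <= j <= m2
     vertfun  f i j   = f_(i+1/2, j+1/2)      0 <= i <= m1,   0 <= j <= m2
   Values outside these ranges are junk: the equations and boundary conditions
   below, imposed only on their index ranges, never mention them.  Likewise
   [i.-1] and [j.-1] are only ever used at positive indices. *)
Definition cellfun (R : realType) := nat -> nat -> R.
Definition ewfun (R : realType) := nat -> nat -> R.
Definition nsfun (R : realType) := nat -> nat -> R.
Definition vertfun (R : realType) := nat -> nat -> R.

Definition gmul {R : realType} (f g : nat -> nat -> R) : nat -> nat -> R :=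
  fun i j => f i j * g i j.
Definition gadd {R : realType} (f g : nat -> nat -> R) : nat -> nat -> R :=
  fun i j => f i j + g i j.
Notation "f \** g" := (gmul f g) (at level 40, left associativity).
Notation "f \++ g" := (gadd f g) (at level 50, left associativity).

Definition inner2 {R : realType} (m1 m2 : nat) (phi psi : cellfun R) : R :=
  \sum_(1 <= i < m1.+1) \sum_(1 <= j < m2.+1) phi i j * psi i j.

Section Operators.
Context {R : realType}.
Implicit Types (h : R) (phi r mub c : cellfun R) (u : ewfun R) (v : nsfun R)
  (f : vertfun R).

(* Lower-case a, d: edge to center; upper-case A, D: center to edge.  The
   suffixes cv, ev, ve stand for center to vertex (calligraphic A), edge to
   vertex (calligraphic A_x, D_x, ...) and vertex to edge (Fraktur). *)
Definition ax u : cellfun R := fun i j => (u i j + u i.-1 j) / 2.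
Definition dx h u : cellfun R := fun i j => (u i j - u i.-1 j) / h.
Definition ay v : cellfun R := fun i j => (v i j + v i j.-1) / 2.
Definition dy h v : cellfun R := fun i j => (v i j - v i j.-1) / h.

Definition Ax phi : ewfun R := fun i j => (phi i.+1 j + phi i j) / 2.
Definition Dx h phi : ewfun R := fun i j => (phi i.+1 j - phi i j) / h.
Definition Ay phi : nsfun R := fun i j => (phi i j.+1 + phi i j) / 2.
Definition Dy h phi : nsfun R := fun i j => (phi i j.+1 - phi i j) / h.

Definition Acv phi : vertfun R := fun i j =>
  (phi i.+1 j.+1 + phi i j.+1 + phi i.+1 j + phi i j) / 4.

Definition Aevx v : vertfun R := fun i j => (v i.+1 j + v i j) / 2.
Definition Devx h v : vertfun R := fun i j => (v i.+1 j - v i j) / h.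
Definition Aevy u : vertfun R := fun i j => (u i j.+1 + u i j) / 2.
Definition Devy h u : vertfun R := fun i j => (u i j.+1 - u i j) / h.

Definition Avex f : nsfun R := fun i j => (f i j + f i.-1 j) / 2.
Definition Dvex h f : nsfun R := fun i j => (f i j - f i.-1 j) / h.
Definition Avey f : ewfun R := fun i j => (f i j + f i j.-1) / 2.
Definition Dvey h f : ewfun R := fun i j => (f i j - f i j.-1) / h.

(* a_x(r_ew D_x c u) and a_y(r_ns D_y c v) *)
Definition adv_ew h r c u : cellfun R := fun i j =>
  (r i.+1 j * Dx h c i j * u i j + r i.-1 j * Dx h c i.-1 j * u i.-1 j) / 2.
Definition adv_ns h r c v : cellfun R := fun i j =>
  (r i j.+1 * Dy h c i j * v i j + r i j.-1 * Dy h c i j.-1 * v i j.-1) / 2.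

(* A_x(r_ew mub) and A_y(r_ns mub) *)
Definition surf_ew r mub : ewfun R := fun i j =>
  (r i.+1 j * mub i j + r i j * mub i.+1 j) / 2.
Definition surf_ns r mub : nsfun R := fun i j =>
  (r i j.+1 * mub i j + r i j * mub i j.+1) / 2.

Definition sqgrad h c : cellfun R :=
  ax (Dx h c \** Dx h c) \++ ay (Dy h c \** Dy h c).

Definition divgrad h (k phi : cellfun R) : cellfun R :=
  dx h (Ax k \** Dx h phi) \++ dy h (Ay k \** Dy h phi).

End Operators.

Record state (R : realType) := State {
  st_c : cellfun R;
  st_mub : cellfun R;
  st_pb : cellfun R;
  st_u : ewfun R;
  st_v : nsfun R }.

Section Scheme.
Context {R : realType}.
Implicit Types (p : params R) (h : R) (m : nat) (s : state R).

Definition rhog p s : cellfun R := fun i j => rho p (st_c s i j).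
Definition viscg p s : cellfun R := fun i j => visc p (st_c s i j).
Definition mobg p s : cellfun R := fun i j => mob p (st_c s i j).

(* Throughout, s0 is the state at level n and s1 the state at level n+1. *)
Definition rho_half p s0 s1 : cellfun R := fun i j =>
  (rhog p s1 i j + rhog p s0 i j) / 2.
Definition c_half s0 s1 : cellfun R := fun i j =>
  (st_c s1 i j + st_c s0 i j) / 2.
Definition F_half s0 s1 : cellfun R := fun i j =>
  (Fdw (st_c s1 i j) + Fdw (st_c s0 i j)) / 2.
Definition sqgrad_half h s0 s1 : cellfun R := fun i j =>
  (sqgrad h (st_c s1) i j + sqgrad h (st_c s0) i j) / 2.

Definition divu h s : cellfun R := dx h (st_u s) \++ dy h (st_v s).

Definition Qsrc p h s0 s1 : cellfun R := fun i j =>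
  (pPe p)^-1 * divgrad h (mobg p s0) (st_mub s1) i j
  + alpha p / pPe p * divgrad h (mobg p s0) (st_pb s1) i j.

Definition momentum_x p h s0 s1 (i j : nat) : Prop :=
  let rho0 := rhog p s0 in let rho1 := rhog p s1 in
  let mu0 := viscg p s0 in
  let u0 := st_u s0 in let u1 := st_u s1 in
  let v0 := st_v s0 in
  Ax rho0 i j * ((u1 i j - u0 i j) / pdt p)
  + Ax (rho0 \** ax u0 \** dx h u1) i j
  + Avey (Acv rho0 \** Aevx v0 \** Devy h u1) i j
  + (Ax rho1 i j - Ax rho0 i j) / (2 * pdt p) * u1 i j
  + 2^-1 * (Dx h (rho0 \** ax u0) i j + Dvey h (Acv rho0 \** Aevx v0) i j)
      * u1 i j
  = - ((pM p)^-1 * Dx h (st_pb s1) i j)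
    + (pM p)^-1 * surf_ew rho0 (st_mub s1) i j * Dx h (st_c s0) i j
    + (pRe p)^-1 * (Dx h (mu0 \** dx h u1) i j
                    + Dvey h (Acv mu0 \** Devy h u1) i j)
    + (3 * pRe p)^-1 * Dx h (mu0 \** divu h s1) i j.

Definition momentum_y p h s0 s1 (i j : nat) : Prop :=
  let rho0 := rhog p s0 in let rho1 := rhog p s1 in
  let mu0 := viscg p s0 in
  let u0 := st_u s0 in
  let v0 := st_v s0 in let v1 := st_v s1 in
  Ay rho0 i j * ((v1 i j - v0 i j) / pdt p)
  + Avex (Acv rho0 \** Aevy u0 \** Devx h v1) i j
  + Ay (rho0 \** ay v0 \** dy h v1) i j
  + (Ay rho1 i j - Ay rho0 i j) / (2 * pdt p) * v1 i j
  + 2^-1 * (Dvex h (Acv rho0 \** Aevy u0) i j + Dy h (rho0 \** ay v0) i j)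
      * v1 i j
  = - ((pM p)^-1 * Dy h (st_pb s1) i j)
    + (pM p)^-1 * surf_ns rho0 (st_mub s1) i j * Dy h (st_c s0) i j
    + (pRe p)^-1 * (Dvex h (Acv mu0 \** Devx h v1) i j
                    + Dy h (mu0 \** dy h v1) i j)
    + (3 * pRe p)^-1 * Dy h (mu0 \** divu h s1) i j
    - (pFr p)^-1 * Ay rho0 i j.

Definition quasi_incompressibility p h s0 s1 (i j : nat) : Prop :=
  divu h s1 i j = alpha p * Qsrc p h s0 s1 i j.

Definition phase_transport p h s0 s1 (i j : nat) : Prop :=
  let rho0 := rhog p s0 in let rho1 := rhog p s1 in
  let c0 := st_c s0 in let c1 := st_c s1 in
  rho1 i j * ((c1 i j - c0 i j) / pdt p)
  + adv_ew h rho0 c0 (st_u s1) i j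
  + adv_ns h rho0 c0 (st_v s1) i j
  = Qsrc p h s0 s1 i j.

Definition chemical_potential p h s0 s1 (i j : nat) : Prop :=
  let c0 := st_c s0 in let c1 := st_c s1 in
  rhog p s1 i j * st_mub s1 i j
  = pM p * peta p / (peps p * pWe p)
      * (rho_half p s0 s1 i j * gdw (c1 i j) (c0 i j))
    + pM p * peta p / (peps p * pWe p)
      * (F_half s0 s1 i j * rfun p (c1 i j) (c0 i j))
    + peps p * peta p * pM p / (2 * pWe p)
      * (sqgrad_half h s0 s1 i j * rfun p (c1 i j) (c0 i j))
    - peps p * peta p * pM p / pWe p
      * divgrad h (rho_half p s0 s1) (c_half s0 s1) i j.

Record primitive_scheme p h m1 m2 s0 s1 : Prop := PrimitiveScheme {
  scheme_P1 : forall i j, (1 <= i < m1)%N -> (1 <= j <= m2)%N ->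
    momentum_x p h s0 s1 i j;
  scheme_P2 : forall i j, (1 <= i <= m1)%N -> (1 <= j < m2)%N ->
    momentum_y p h s0 s1 i j;
  scheme_P3 : forall i j, (1 <= i <= m1)%N -> (1 <= j <= m2)%N ->
    quasi_incompressibility p h s0 s1 i j;
  scheme_P4 : forall i j, (1 <= i <= m1)%N -> (1 <= j <= m2)%N ->
    phase_transport p h s0 s1 i j;
  scheme_P5 : forall i j, (1 <= i <= m1)%N -> (1 <= j <= m2)%N ->
    chemical_potential p h s0 s1 i j }.

Record neumann m1 m2 (phi : cellfun R) : Prop := Neumann {
  neumann_x : forall j, (1 <= j <= m2)%N ->
    phi 0%N j = phi 1%N j /\ phi m1.+1 j = phi m1 j;
  neumann_y : forall i, (1 <= i <= m1)%N ->
    phi i 0%N = phi i 1%N /\ phi i m2.+1 = phi i m2 }.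

Record no_slip m1 m2 (u : ewfun R) (v : nsfun R) : Prop := NoSlip {
  no_slip_u_normal : forall j, (1 <= j <= m2)%N ->
    u 0%N j = 0 /\ u m1 j = 0;
  no_slip_u_tangential : forall i, (i <= m1)%N ->
    (u i 0%N + u i 1%N) / 2 = 0 /\ (u i m2 + u i m2.+1) / 2 = 0;
  no_slip_v_normal : forall i, (1 <= i <= m1)%N ->
    v i 0%N = 0 /\ v i m2 = 0;
  no_slip_v_tangential : forall j, (j <= m2)%N ->
    (v 0%N j + v 1%N j) / 2 = 0 /\ (v m1 j + v m1.+1 j) / 2 = 0 }.

Definition mu_c p s : cellfun R := fun i j =>
  st_mub s i j + alpha p * st_pb s i j.

Record boundary_conditions p m1 m2 s : Prop := BoundaryConditions {
  bc_c : neumann m1 m2 (st_c s);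
  bc_mu : neumann m1 m2 (mu_c p s);
  bc_u : no_slip m1 m2 (st_u s) (st_v s) }.

Definition admissible p m1 m2 s : Prop :=
  forall i j, (i <= m1.+1)%N -> (j <= m2.+1)%N ->
    0 < (prho2 p - prho1 p) * st_c s i j + prho1 p /\
    0 < (pmu2 p - pmu1 p) * st_c s i j + pmu1 p.

End Scheme.

(* Main.v *)
Require Import Defs.
From mathcomp Require Import all_boot all_order all_algebra.
From mathcomp Require Import reals.
From mathcomp Require Import ring.
Import Order.TTheory GRing.Theory Num.Theory.
Local Open Scope ring_scope.

(** The scheme contains no discrete mass balance as such, but one follows from
    its phase-field and quasi-incompressibility equations, because [1 / rho] is
    affine in the concentration with slope [alpha].  This makes the difference
    quotient of [rho] exact, [rho a - rho b = - alpha rho(a) rho(b) (a - b)]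
    (lemma [rho_sub]), both between two time levels and between two
    neighbouring cells.

    Multiply the phase transport equation by [alpha rho^n].  Its time difference
    becomes that of [- rho], its right-hand side becomes [rho^n] times the
    divergence of the new velocity by quasi-incompressibility, and in the advection terms the shifted density
    [rho_ew] (or [rho_ns]) is exactly the second factor needed to turn
    [alpha rho^n rho_ew D_x c^n] into [- D_x rho^n].  The discrete product rule
    [a_x (D_x r u) + r d_x u = d_x (A_x r u)] then gives the continuity equation
    [(rho^(n+1) - rho^n) / dt + d_x (A_x rho^n u^(n+1))
     + d_y (A_y rho^n v^(n+1)) = 0]
    in every cell (lemma [discrete_continuity]).  Summed over the grid, the two
    fluxes telescope to boundary values, which vanish by no-slip. *)

Section MassConservation.
Context {R : realType}.
Implicit Types (p : params R) (h : R) (s : state R).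

(** From [1 / rho c = alpha c + 1 / rho_2]. *)
Lemma rho_sub p (a b : R) : params_pos p ->
  (prho2 p - prho1 p) * a + prho1 p != 0 ->
  (prho2 p - prho1 p) * b + prho1 p != 0 ->
  rho p a - rho p b = rfun p a b * (a - b).
Proof.
move=> p_pos a_neq0 b_neq0; rewrite /rfun /rho /alpha.
field; rewrite a_neq0 b_neq0 /=.
by rewrite (lt0r_neq0 (prho1_gt0 p_pos)) (lt0r_neq0 (prho2_gt0 p_pos)).
Qed.

Lemma rhog_sub {p m1 m2 s s'} (i j i' j' : nat) : params_pos p ->
  admissible p m1 m2 s -> admissible p m1 m2 s' ->
  (i <= m1.+1)%N -> (j <= m2.+1)%N -> (i' <= m1.+1)%N -> (j' <= m2.+1)%N ->
  rhog p s i j - rhog p s' i' j'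
  = - alpha p * rhog p s i j * rhog p s' i' j' * (st_c s i j - st_c s' i' j').
Proof.
move=> p_pos adm adm' lei lej lei' lej'; apply: rho_sub => //.
- by rewrite lt0r_neq0 //; case: (adm i j lei lej).
- by rewrite lt0r_neq0 //; case: (adm' i' j' lei' lej').
Qed.

(** The value of [r] at the centre of the cell, times the neighbouring value
    chosen by [adv_ew], is the product of the two values at the ends of each
    edge; so [alpha r] times the advection term is a difference of [r], and the
    product rule collects it with the divergence into one flux. *)
Lemma advection_flux (alpha h r_ r r' c_ c c' u_ u : R) :
  r - r_ = - alpha * r * r_ * (c - c_) ->
  r' - r = - alpha * r' * r * (c' - c) ->
  r * ((u - u_) / h)
    - alpha * r * ((r' * ((c' - c) / h) * u + r_ * ((c - c_) / h) * u_) / 2)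
  = ((r' + r) / 2 * u - (r + r_) / 2 * u_) / h.
Proof.
move=> rl rr.
transitivity (((u - u_) * r + ((- alpha * r' * r * (c' - c)) * u
              + (- alpha * r * r_ * (c - c_)) * u_) / 2) / h).
  by ring.
by rewrite -rl -rr; congr (_ / h); field.
Qed.

(** Substituting the two product rules and [rho_sub] in time, the left-hand side
    is [rho^n] times the residual of quasi-incompressibility, in which the source
    has been replaced by the phase transport operator.  Cells next to a wall use
    ghost densities, so admissibility has to include the ghost points. *)
Lemma discrete_continuity p h m1 m2 s0 s1 : params_pos p ->
  admissible p m1 m2 s0 -> admissible p m1 m2 s1 ->
  forall i j, (1 <= i <= m1)%N -> (1 <= j <= m2)%N ->
  quasi_incompressibility p h s0 s1 i j -> phase_transport p h s0 s1 i j ->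
  (rhog p s1 i j - rhog p s0 i j) / pdt p
  + dx h (Ax (rhog p s0) \** st_u s1) i j
  + dy h (Ay (rhog p s0) \** st_v s1) i j = 0.
Proof.
move=> p_pos adm0 adm1 [//|i] [//|j] /= lei lej divE transE.
have lei' := leqW (ltnW lei); have lej' := leqW (ltnW lej).
have fluxx := advection_flux (alpha p) h _ _ _ _ _ _ (st_u s1 i j.+1)
  (st_u s1 i.+1 j.+1)
  (rhog_sub i.+1 j.+1 i j.+1 p_pos adm0 adm0 (leqW lei) (leqW lej) lei'
    (leqW lej))
  (rhog_sub i.+2 j.+1 i.+1 j.+1 p_pos adm0 adm0 lei (leqW lej) (leqW lei)
    (leqW lej)).
have fluxy := advection_flux (alpha p) h _ _ _ _ _ _ (st_v s1 i.+1 j)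
  (st_v s1 i.+1 j.+1)
  (rhog_sub i.+1 j.+1 i.+1 j p_pos adm0 adm0 (leqW lei) (leqW lej) (leqW lei)
    lej')
  (rhog_sub i.+1 j.+2 i.+1 j.+1 p_pos adm0 adm0 (leqW lei) lej (leqW lei)
    (leqW lej)).
have drho := rhog_sub i.+1 j.+1 i.+1 j.+1 p_pos adm1 adm0 (leqW lei) (leqW lej)
  (leqW lei) (leqW lej).
rewrite drho /dx /dy /Ax /Ay /gmul /= -fluxx -fluxy.
move: divE; rewrite /quasi_incompressibility -transE => divE.
transitivity (rhog p s0 i.+1 j.+1 * (divu h s1 i.+1 j.+1
  - alpha p * (rhog p s1 i.+1 j.+1
      * ((st_c s1 i.+1 j.+1 - st_c s0 i.+1 j.+1) / pdt p)
    + adv_ew h (rhog p s0) (st_c s0) (st_u s1) i.+1 j.+1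
    + adv_ns h (rhog p s0) (st_c s0) (st_v s1) i.+1 j.+1))).
  by rewrite /divu /gadd /dx /dy /adv_ew /adv_ns /Dx /Dy /=; ring.
by rewrite divE subrr mulr0.
Qed.

(** The discrete divergence theorem: each row of [f] and each column of [g]
    telescopes to the difference of its wall values. *)
Lemma sum_div_eq0 h m1 m2 (f : ewfun R) (g : nsfun R) :
  (forall j, (1 <= j <= m2)%N -> f 0%N j = 0 /\ f m1 j = 0) ->
  (forall i, (1 <= i <= m1)%N -> g i 0%N = 0 /\ g i m2 = 0) ->
  \sum_(1 <= i < m1.+1) \sum_(1 <= j < m2.+1) (dx h f i j + dy h g i j) = 0.
Proof.
move=> f0 g0.
under eq_bigr do rewrite big_split /=.
rewrite big_split /= exchange_big /=.
rewrite !big_nat !big1 ?addr0 // => [i|j] /[1!ltnS] rg.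
- rewrite /dy -mulr_suml big_add1 /= telescope_sumr //.
  by case: (g0 i rg) => -> ->; rewrite subr0 mul0r.
- rewrite /dx -mulr_suml big_add1 /= telescope_sumr //.
  by case: (f0 j rg) => -> ->; rewrite subr0 mul0r.
Qed.

End MassConservation.

Theorem theorem6p1 (R : realType) (p : params R) (Lx Ly h : R) (m1 m2 : nat)
    (s : nat -> state R)
    (p_pos : params_pos p)
    (h_gt0 : 0 < h) (m1_gt0 : (0 < m1)%N) (m2_gt0 : (0 < m2)%N)
    (LxE : Lx = m1%:R * h) (LyE : Ly = m2%:R * h) (LxLy : Lx = Ly)
    (s_adm : forall n : nat, admissible p m1 m2 (s n))
    (s_bc : forall n : nat, boundary_conditions p m1 m2 (s n))
    (s_scheme : forall n : nat, primitive_scheme p h m1 m2 (s n) (s n.+1)) :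
  forall n : nat,
    inner2 m1 m2 (rhog p (s n.+1)) (fun _ _ => 1)
    = inner2 m1 m2 (rhog p (s n)) (fun _ _ => 1).
Proof.
move=> n; apply/eqP; rewrite -subr_eq0 /inner2 -sumrB.
under eq_bigr do rewrite -sumrB.
set f := Ax (rhog p (s n)) \** st_u (s n.+1).
set g := Ay (rhog p (s n)) \** st_v (s n.+1).
have [_ _ [u_wall _ v_wall _]] := s_bc n.+1.
have [_ _ P3 P4 _] := s_scheme n.
have dt_neq0 : pdt p != 0 by rewrite lt0r_neq0 // pdt_gt0.
have flux0 : \sum_(1 <= i < m1.+1) \sum_(1 <= j < m2.+1)
    (dx h f i j + dy h g i j) = 0.
  apply: sum_div_eq0 => [j /u_wall[u0 u1]|i /v_wall[v0 v1]].
  - by rewrite /f /gmul u0 u1 !mulr0.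
  - by rewrite /g /gmul v0 v1 !mulr0.
apply/eqP; rewrite -[RHS](mulr0 (- pdt p)) -[in RHS]flux0 mulr_sumr.
apply: eq_big_nat => i; rewrite ltnS => rgi.
rewrite mulr_sumr; apply: eq_big_nat => j; rewrite ltnS => rgj.
have := discrete_continuity p h m1 m2 (s n) (s n.+1) p_pos (s_adm n)
  (s_adm n.+1) i j rgi rgj (P3 i j rgi rgj) (P4 i j rgi rgj).
rewrite -/f -/g -addrA => /eqP; rewrite addrC addr_eq0 => /eqP ->.
by field.
Qed.
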